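(* $\mathbb{D}^{1,2}\cap\mathcal{SC}$ does not contain any non-trivial central element: if $F\in\mathbb{D}^{1,2}\cap\mathcal{SC}$ commutes with every element of $\mathcal{SC}$, then $F\in\mathbb{C}\cdot1$.
   Context: Setting. Inner products are linear in the first variable. On the full Fock space $\mathbb{C}\Omega\oplus\bigoplus_{n\ge1}L^2(\mathbb{R}_+)^{\otimes n}$ (complex $L^2$, $\|\Omega\|=1$), let $l(h)$ be the left creation operator, $l(h)\Omega=h$, $l(h)(g_1\otimes\cdots\otimes g_n)=h\otimes g_1\otimes\cdots\otimes g_n$, and for real-valued $h\in L^2_{\mathbb{R}}(\mathbb{R}_+)$ let $S(h)=l(h)+l(h)^*$. $\mathcal{SC}$ is the von Neumann algebra generated by $\{S(h):h\in L^2_{\mathbb{R}}(\mathbb{R}_+)\}$ and $\tau(X)=\langle X\Omega,\Omega\rangle$ its faithful normal tracial state; $L^2(\mathcal{SC})$ has inner product $\langle X,Y\rangle=\tau(Y^*X)$. $\mathcal{SC}_{alg}$ is the unital $*$-algebra generated by the $S(h)$, $h\in L^2_{\mathbb{R}}(\mathbb{R}_+)$. Malliavin derivative. $\mathcal{B}_2=L^2(\mathbb{R}_+;L^2(\mathcal{SC}\otimes\mathcal{SC}^{op},\tau\otimes\tau^{op}))$. $\nabla:\mathcal{SC}_{alg}\to\mathcal{B}_2$, $A\mapsto(\nabla_tA)_{t\ge0}$, is the linear map with $\nabla_tS(h)=h(t)\,1\otimes1$ and $\nabla_t(AB)=A\cdot\nabla_tB+\nabla_tA\cdot B$, where $A\cdot(x\otimes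 y)\cdot B=Ax\otimes yB$. It is closable from $L^2(\mathcal{SC})$ to $\mathcal{B}_2$; its closure is still denoted $\nabla$, with domain $\mathbb{D}^{1,2}$, the completion of $\mathcal{SC}_{alg}$ for $\|F\|_{1,2}^2=\|F\|_2^2+\|\nabla F\|_{\mathcal{B}_2}^2$. *)

(* Defs.v *)
From mathcomp Require Import all_boot all_order all_algebra.
From mathcomp Require Import complex.
From mathcomp Require Import all_classical all_reals all_analysis.

Set Implicit Arguments.
Unset Strict Implicit.
Unset Printing Implicit Defensive.

Import Order.TTheory GRing.Theory Num.Theory.
Import numFieldNormedType.Exports.

Local Open Scope classical_set_scope.
Local Open Scope ring_scope.
Local Open Scope complex_scope.

(* [dot] is linear in the first variable and conjugate-linear in the second. *)
Record hilbert (R : realType) := Hilbert {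
  hspace :> completeNormedModType R[i] ;
  dot : {dot hspace for @Num.conj R[i]} ;
  dot_norm : forall x : hspace, dot x x = `|x| ^+ 2 }.

Definition ip (R : realType) (H : hilbert R) (u v : H) : R[i] := dot H u v.

Definition normsq (R : realType) (H : hilbert R) (v : H) : R :=
  complex.Re (ip v v).

Definition linspan (R : realType) (H : hilbert R) : set H -> set H :=
  smallest [set M | M 0 /\
    forall (a : R[i]) (u v : H), M u -> M v -> M (a *: u + v)].

Definition total (R : realType) (H : hilbert R) (S : set H) : Prop :=
  closure (linspan S) = setT.

Definition bounded_op (R : realType) (H : hilbert R) : set (H -> H) :=
  [set T | linear T /\ exists c : R, forall v, `|T v| <= c%:C * `|v|].

(* Total by convention: for bounded [T] the adjoint exists and is unique, so the
   default value [0] is not used.  The same applies to [creation] on L^2 functions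
   and to [biact] on elements of SC, both determined on a total set. *)
Definition adj (R : realType) (H : hilbert R) (T : H -> H) : H -> H :=
  xget 0 [set T' : H -> H | bounded_op T' /\
                            forall u v : H, ip (T u) v = ip u (T' v)].

Definition star_algebra (R : realType) (H : hilbert R) (M : set (H -> H)) :=
  [/\ M `<=` @bounded_op R H,
      M idfun,
      forall (a : R[i]) X Y, M X -> M Y -> M (a *: X + Y),
      forall X Y, M X -> M Y -> M (X \o Y)
    & forall X, M X -> M (adj X)].

Definition wot_closed (R : realType) (H : hilbert R) (M : set (H -> H)) :=
  forall T : H -> H, bounded_op T ->
    (forall (s : seq (H * H)) (e : R), 0 < e -> exists2 X, M X &
       forall p, p \in s -> `|ip (T p.1 - X p.1) p.2| < e%:C) ->
    M T.

Definition von_neumann_algebra (R : realType) (H : hilbert R)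
  (M : set (H -> H)) := star_algebra M /\ wot_closed M.

(* Lebesgue measure on [R_+], seen as a measure on [R] that does not charge the
   negative half-line: the values of a function on ]-oo, 0[ are irrelevant. *)
Definition lebRp (R : realType) : {measure set (measurableTypeR R) -> \bar R} :=
  mrestr (@lebesgue_measure R) (measurable_itv `[0, +oo[).

Definition L2R (R : realType) : set (R -> R) :=
  [set h | h \in Lfun (lebRp R) 2%:E].

Definition L2C (R : realType) : set (R -> R[i]) :=
  [set h | L2R (fun t => complex.Re (h t)) /\ L2R (fun t => complex.Im (h t))].

Definition L2seq (R : realType) : set (seq (R -> R[i])) :=
  [set gs : seq (R -> R[i]) | {in gs, forall g, L2C g}].

Definition dotL2 (R : realType) (f g : R -> R[i]) : R[i] :=
  let k t := f t * (g t)^* in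
  (\int[lebRp R]_t complex.Re (k t)) +i* (\int[lebRp R]_t complex.Im (k t)).

(* The Hilbert space C Omega (+) (+)_(n >= 1) L^2(R_+)^(tensor n), given
   together with its simple tensors [tens [:: g1; ...; gn]] = g1 (x) ... (x) gn,
   where [tens [::]] = Omega.  The Gram formula and totality are the definition
   of the Hilbert tensor powers and of their orthogonal sum; the formula also
   forces [tens] to be multilinear and compatible with a.e. equality. *)
Record fock (R : realType) := Fock {
  fspace :> hilbert R ;
  tens : seq (R -> R[i]) -> fspace ;
  dot_tens : forall fs gs, L2seq fs -> L2seq gs ->
    ip (tens fs) (tens gs) =
      if size fs == size gs then \prod_(p <- zip fs gs) dotL2 p.1 p.2 else 0 ;
  total_tens : total (tens @` @L2seq R) }.

Definition vacuum (R : realType) (K : fock R) : K := tens K [::].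

Definition creation (R : realType) (K : fock R) (h : R -> R[i]) : K -> K :=
  xget 0 [set L : K -> K | bounded_op L /\
    forall gs, L2seq gs -> L (tens K gs) = tens K (h :: gs)].

Arguments creation {R} K h _.

Definition field_op (R : realType) (K : fock R) (h : R -> R) : K -> K :=
  let l := creation K (fun t => (h t)%:C) in l + adj l.

Arguments field_op {R} K h _.

Definition SC (R : realType) (K : fock R) : set (K -> K) :=
  smallest (@von_neumann_algebra R K) (field_op K @` @L2R R).

Definition SCalg (R : realType) (K : fock R) : set (K -> K) :=
  smallest (@star_algebra R K) (field_op K @` @L2R R).

Definition tau (R : realType) (K : fock R) (X : K -> K) : R[i] :=
  ip (X (vacuum K)) (vacuum K).

Definition normL2SC (R : realType) (K : fock R) (X : K -> K) : R :=
  Num.sqrt (complex.Re (tau (adj X \o X))).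

(* The Gram formula reads
     <x (x) y, u (x) v> = (tau (x) tau^op) (u* x (x) y v* )
                        = tau (u* x) tau (y v* ),
   where y v* is the product of v* and y in SC^op.  By Kaplansky
   density the algebraic tensor product is dense in L^2 of the von Neumann
   tensor product. *)
Record L2SCSCop (R : realType) (K : fock R) := L2SCSCOp {
  l2space :> hilbert R ;
  otimes : (K -> K) -> (K -> K) -> l2space ;
  dot_otimes : forall x y u v, SC x -> SC y -> SC u -> SC v ->
    ip (otimes x y) (otimes u v) = tau (adj u \o x) * tau (y \o adj v) ;
  total_otimes : total [set w | exists x y, [/\ SC x, SC y & w = otimes x y]] }.

(* The bimodule operation w |-> A . w . B on L^2(SC (x) SC^op). *)
Definition biact (R : realType) (K : fock R) (L : L2SCSCop K) (A B : K -> K) :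
    L -> L :=
  xget 0 [set T : L -> L | bounded_op T /\
    forall x y, SC x -> SC y -> T (otimes L x y) = otimes L (A \o x) (y \o B)].

Arguments biact {R K} L A B _.

(* Weak measurability is strong measurability here, as L^2(SC (x) SC^op) is
   separable. *)
Definition B2 (R : realType) (K : fock R) (L : L2SCSCop K) : set (R -> L) :=
  [set u |
    (forall w : L, measurable_fun [set: R] (fun t => complex.Re (ip (u t) w)) /\
                   measurable_fun [set: R] (fun t => complex.Im (ip (u t) w))) /\
    (\int[lebRp R]_t (normsq (u t))%:E < +oo)%E].

Record malliavin (R : realType) (K : fock R) (L : L2SCSCop K)
    (nabla : (K -> K) -> R -> L) : Prop := Malliavin {
  nabla_B2 : forall A, SCalg A -> B2 (nabla A) ;
  nabla_linear : forall (a : R[i]) A B, SCalg A -> SCalg B ->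
    {ae lebRp R, forall t, nabla (a *: A + B) t = a *: nabla A t + nabla B t} ;
  nabla_field : forall h, L2R h ->
    {ae lebRp R, forall t,
       nabla (field_op K h) t = (h t)%:C *: otimes L idfun idfun} ;
  nabla_mul : forall A B, SCalg A -> SCalg B ->
    {ae lebRp R, forall t, nabla (A \o B) t =
       biact L A idfun (nabla B t) + biact L idfun B (nabla A t)} }.

(* The elements of SC that lie in the domain D^{1,2} of the closure of [nabla],
   as an operator from L^2(SC) to B_2. *)
Definition D12_SC (R : realType) (K : fock R) (L : L2SCSCop K)
    (nabla : (K -> K) -> R -> L) : set (K -> K) :=
  [set F | SC F /\
    exists (A : nat -> K -> K) (D : R -> L),
      [/\ forall n, SCalg (A n),
          B2 D,
          (fun n => normL2SC (F - A n)) @ \oo --> (0 : R)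
        & (fun n => \int[lebRp R]_t (normsq (D t - nabla (A n) t))%:E)%E
            @ \oo --> 0%E]].

(* Main.v *)
(* SC is a factor: a central F commutes with the field operators S(h),
   and also with their mirror images S_r(h) = W S(h) W, where W reverses simple
   tensors, since S and S_r commute. As S(h) Omega = S_r(h) Omega, the vector
   x = F Omega - <F Omega, Omega> Omega satisfies S(h) x = S_r(h) x, that is
   l(h) x - r(h) x = r(h)* x - l(h)* x. For an orthonormal family (h_i), Bessel's
   inequality makes l(h_i)* x and r(h_i)* x small for some i, whereas l(h_i) x
   and r(h_i) x are almost orthogonal vectors of norm |x|; hence x = 0. Since F
   commutes with SC, for which Omega is cyclic, F is scalar. *)
Require Import Defs.
From mathcomp Require Import all_boot all_order all_algebra.
From mathcomp Require Import complex ring lra.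
From mathcomp Require Import all_classical all_reals all_analysis.

Set Implicit Arguments.
Unset Strict Implicit.
Unset Printing Implicit Defensive.

Import Order.TTheory GRing.Theory Num.Theory.
Import numFieldNormedType.Exports.

Local Open Scope classical_set_scope.
Local Open Scope ring_scope.
Local Open Scope complex_scope.

(** * Bounded operators determined on a total family *)

Section Hilbert.
Variables (R : realType) (H : hilbert R).
Implicit Types (u v w x y : H) (a b : R[i]) (T : H -> H).

Lemma ipPl a u v w : ip (a *: u + v) w = a * ip u w + ip v w.
Proof. exact: linearPl. Qed.

Lemma ipPr a u v w : ip w (a *: u + v) = Num.conj a * ip w u + ip w v.
Proof. exact: linearPr. Qed.

Lemma ip0l w : ip (0 : H) w = 0. Proof. exact: linear0l. Qed.
Lemma ip0r w : ip w (0 : H) = 0. Proof. exact: linear0r. Qed.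
Lemma ipZl a u w : ip (a *: u) w = a * ip u w.
Proof. by rewrite -[a *: u]addr0 ipPl ip0l addr0. Qed.
Lemma ipZr a u w : ip w (a *: u) = Num.conj a * ip w u.
Proof. by rewrite -[a *: u]addr0 ipPr ip0r addr0. Qed.
Lemma ipDl u v w : ip (u + v) w = ip u w + ip v w.
Proof. exact: linearDl. Qed.
Lemma ipDr u v w : ip w (u + v) = ip w u + ip w v.
Proof. exact: linearDr. Qed.
Lemma ipBl u v w : ip (u - v) w = ip u w - ip v w.
Proof. exact: linearBl. Qed.
Lemma ipBr u v w : ip w (u - v) = ip w u - ip w v.
Proof. exact: linearBr. Qed.
Lemma ipC u v : ip u v = Num.conj (ip v u).
Proof. by rewrite /ip hermC expr0 mul1r. Qed.

Lemma ip_self u : ip u u = `|u| ^+ 2. Proof. exact: dot_norm. Qed.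

Lemma ip_self_eq0 u : ip u u = 0 -> u = 0.
Proof. by rewrite ip_self => /eqP; rewrite expf_eq0 /= normr_eq0 => /eqP. Qed.

Lemma CauchySchwarz_ip u v : `|ip u v| <= `|u| * `|v|.
Proof.
have [->|v0] := eqVneq v 0; first by rewrite ip0r !normr0 mulr0.
have v2 : 0 < `|v| ^+ 2 by rewrite exprn_gt0 // normr_gt0.
have cv : Num.conj (`|v| ^+ 2) = `|v| ^+ 2.
  by apply/CrealP; rewrite rpredX // normr_real.
(* Up to the factor [|v| ^+ 2], this is the component of [u] orthogonal to [v]; the scaling avoids a
   division. *)
pose w := `|v| ^+ 2 *: u - ip u v *: v.
have E : `|w| ^+ 2 = `|v| ^+ 2 * ((`|u| * `|v|) ^+ 2 - `|ip u v| ^+ 2).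
  rewrite -(ip_self w) /w ipBl !ipBr !ipZl !ipZr cv !ip_self.
  by rewrite (ipC v u) normCK; ring.
have : 0 <= `|w| ^+ 2 by rewrite exprn_ge0.
rewrite E pmulr_rge0 // subr_ge0 ler_pXn2r ?nnegrE //.
Qed.

(** Density arguments end with an error of the form constant times [e]. The norm takes values in
    [R[i]], so the limit is taken on its real representative, and [c] may have any sign. *)
Lemma norm_le_eps_eq0 (V : normedZmodType R[i]) (c : R) (x : V) :
  (forall e : R, 0 < e -> `|x| <= (c * e)%:C) -> x = 0.
Proof.
move=> h; apply/eqP; rewrite -normr_eq0; apply/eqP/le_anti.
rewrite normr_ge0 andbT.
have [r Er] : exists r, `|x| = r%:C.
  by apply/complex_realP; apply: normr_real.
rewrite Er lecR; apply/ler_addgt0Pl => e e0; rewrite addr0.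
have c0 : 0 < `|c| + 1 by rewrite ltr_wpDl.
have := h (e / (`|c| + 1)) (divr_gt0 e0 c0); rewrite Er lecR => /le_trans; apply.
rewrite mulrA ler_pdivrMr // mulrDr mulr1 mulrC.
by rewrite (le_trans (ler_wpM2l (ltW e0) (ler_norm c))) // lerDl ltW.
Qed.

Lemma bounded_op_ge0 T : bounded_op T ->
  exists2 c : R, 0 <= c & forall v, `|T v| <= c%:C * `|v|.
Proof.
move=> [_ [c hc]]; exists `|c|; first exact: normr_ge0.
by move=> v; rewrite (le_trans (hc v)) // ler_wpM2r // lecR ler_norm.
Qed.

Lemma boundedP T a u v : bounded_op T -> T (a *: u + v) = a *: T u + T v.
Proof. by move=> [lT _]; exact: lT. Qed.

Lemma bounded0 T : bounded_op T -> T 0 = 0.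
Proof.
by move=> bT; have := boundedP (-1) 0 0 bT; rewrite scaler0 addr0 scaleN1r addNr.
Qed.

Lemma boundedD T u v : bounded_op T -> T (u + v) = T u + T v.
Proof. by move=> bT; rewrite -[u]scale1r boundedP // !scale1r. Qed.

Lemma boundedZ T a u : bounded_op T -> T (a *: u) = a *: T u.
Proof. by move=> bT; rewrite -[a *: u]addr0 boundedP // bounded0 // addr0. Qed.

Lemma boundedB T u v : bounded_op T -> T (u - v) = T u - T v.
Proof. by move=> bT; rewrite boundedD // -scaleN1r boundedZ // scaleN1r. Qed.

Lemma bounded_comp T T' : bounded_op T -> bounded_op T' -> bounded_op (T \o T').
Proof.
move=> bT bT'; split; first by move=> a u v /=; rewrite !boundedP.
have [c c0 hc] := bounded_op_ge0 bT; have [d d0 hd] := bounded_op_ge0 bT'.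
exists (c * d) => v /=; rewrite (le_trans (hc _)) // rmorphM /= -mulrA.
by rewrite ler_wpM2l // ler0c.
Qed.

Lemma bounded_scaleD T T' a :
  bounded_op T -> bounded_op T' -> bounded_op (a *: T + T').
Proof.
move=> bT bT'; split.
  move=> b u v.
  change (a *: T (b *: u + v) + T' (b *: u + v) =
    b *: (a *: T u + T' u) + (a *: T v + T' v)).
  rewrite (boundedP _ _ _ bT) (boundedP _ _ _ bT') !scalerDr !scalerA (mulrC a b).
  by rewrite -!addrA; congr (_ + _); rewrite addrCA.
have [c c0 hc] := bounded_op_ge0 bT; have [d d0 hd] := bounded_op_ge0 bT'.
have [r Er] : exists r, `|a| = r%:C.
  by apply/complex_realP; apply: normr_real.
exists (r * c + d) => v; rewrite [(_ + _) v]/(a *: T v + T' v).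
rewrite (le_trans (ler_normD _ _)) //.
rewrite rmorphD rmorphM /= mulrDl lerD // normrZ Er -mulrA ler_wpM2l //.
by rewrite -Er.
Qed.

Lemma bounded_idfun : bounded_op (idfun : H -> H).
Proof. by split=> //; exists 1 => v /=; rewrite mul1r. Qed.

Lemma bounded_zero : bounded_op (0 : H -> H).
Proof.
split.
  by move=> a u v; change ((0 : H) = a *: (0 : H) + (0 : H)); rewrite scaler0 addr0.
by exists 0 => v; change (`|0 : H| <= 0%:C * `|v|); rewrite normr0 mul0r.
Qed.

Lemma bounded_add T T' : bounded_op T -> bounded_op T' -> bounded_op (T + T').
Proof. by move=> bT bT'; rewrite -[T]scale1r; exact: bounded_scaleD. Qed.

Lemma rank_one_bounded v w : bounded_op (fun u => ip u v *: w).
Proof.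
split; first by move=> a x y; rewrite ipPl scalerDl scalerA.
have [r Er] : exists r, `|v| * `|w| = r%:C.
  by apply/complex_realP; rewrite realM // normr_real.
by exists r => u; rewrite normrZ -Er mulrAC ler_wpM2r // mulrC CauchySchwarz_ip.
Qed.

(** Lists allow repeated indices: addition is concatenation, and [I] needs no decidable equality. *)
Definition comb I (e : I -> H) (s : seq (R[i] * I)) := \sum_(p <- s) p.1 *: e p.2.

Lemma comb_scale_cat I (e : I -> H) a s t :
  comb e ([seq (a * p.1, p.2) | p <- s] ++ t) = a *: comb e s + comb e t.
Proof.
rewrite /comb big_cat big_map /= scaler_sumr; congr (_ + _).
by apply: eq_bigr => p _; rewrite scalerA.
Qed.

Lemma bounded_comb I (e : I -> H) T s :
  bounded_op T -> T (comb e s) = comb (T \o e) s.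
Proof.
move=> bT; rewrite /comb; elim: s => [|p s ih]; first by rewrite !big_nil bounded0.
by rewrite !big_cons boundedP // ih.
Qed.

Lemma ip_combl I (e : I -> H) s w :
  ip (comb e s) w = \sum_(p <- s) p.1 * ip (e p.2) w.
Proof.
rewrite /comb; elim: s => [|p s ih]; first by rewrite !big_nil ip0l.
by rewrite !big_cons ipPl ih.
Qed.

Lemma ip_combr I (e : I -> H) s w :
  ip w (comb e s) = \sum_(p <- s) Num.conj p.1 * ip w (e p.2).
Proof.
rewrite /comb; elim: s => [|p s ih]; first by rewrite !big_nil ip0r.
by rewrite !big_cons ipPr ih.
Qed.

Lemma total_approx I (e : I -> H) : Defs.total (range e) ->
  forall v (eps : R), 0 < eps -> exists s, `|v - comb e s| <= eps%:C.
Proof.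
move=> te v eps e0.
have : closure (linspan (range e)) v by rewrite te.
move=> /(_ (ball v eps%:C)) [].
  by apply: nbhsx_ballx; rewrite ltcR.
move=> w [sw bw].
(* The finite combinations form a subspace containing the family, hence contain its linear span. *)
have [s Es] : [set w | exists s, w = comb e s] w.
  apply: sw; split; first split.
  - by exists [::]; rewrite /comb big_nil.
  - by move=> a _ _ [s ->] [t ->]; exists ([seq (a * p.1, p.2) | p <- s] ++ t);
      rewrite comb_scale_cat.
  - by move=> _ [i _ <-]; exists [:: (1, i)]; rewrite /comb big_seq1 scale1r.
by exists s; rewrite -Es; apply: ltW; move: bw; rewrite -ball_normE.
Qed.

Section Total.
Variables (I : Type) (e : I -> H).
Hypothesis te : Defs.total (range e).

Lemma bounded_eq T T' : bounded_op T -> bounded_op T' ->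
  (forall i, T (e i) = T' (e i)) -> T = T'.
Proof.
move=> bT bT' h; apply/funext => v; apply/subr0_eq.
have [c c0 hc] := bounded_op_ge0 bT; have [d d0 hd] := bounded_op_ge0 bT'.
apply: (@norm_le_eps_eq0 _ (c + d)) => eps e0.
have [s hs] := total_approx te v e0.
have -> : T v - T' v = T (v - comb e s) - T' (v - comb e s).
  rewrite (boundedB _ _ bT) (boundedB _ _ bT') (bounded_comb _ _ bT).
  rewrite (bounded_comb _ _ bT') (_ : T' \o e = T \o e).
    by rewrite opprB addrA subrK.
  by apply/funext => i /=; rewrite h.
rewrite (le_trans (ler_normB _ _)) // mulrDl rmorphD !rmorphM /=.
by rewrite lerD // (le_trans (hc _), le_trans (hd _)) // ler_wpM2l // ler0c.
Qed.

(** Both sides are continuous and conjugate-linear in [w]. With [T] the identity this separates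
    vectors; with general [T] it extends adjoint relations from the family to the whole space. *)
Lemma ip_total_eq T x y : bounded_op T ->
  (forall i, ip x (e i) = ip y (T (e i))) -> forall w, ip x w = ip y (T w).
Proof.
move=> bT h w; apply/subr0_eq.
have [c c0 hc] := bounded_op_ge0 bT.
have [r Er] : exists r, `|x| = r%:C.
  by apply/complex_realP; apply: normr_real.
have [t Et] : exists r, `|y| = r%:C.
  by apply/complex_realP; apply: normr_real.
have r0 : 0 <= r by rewrite -ler0c -Er.
have t0 : 0 <= t by rewrite -ler0c -Et.
apply: (@norm_le_eps_eq0 _ (r + t * c)) => eps e0.
have [s hs] := total_approx te w e0.
have -> : ip x w - ip y (T w) = ip x (w - comb e s) - ip y (T (w - comb e s)).
  rewrite (boundedB _ _ bT) (bounded_comb _ _ bT) !ipBr !ip_combr.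
  rewrite (eq_bigr (fun p => Num.conj p.1 * ip y ((T \o e) p.2))); first by ring.
  by move=> p _; rewrite h.
rewrite (le_trans (ler_normB _ _)) // mulrDl rmorphD !rmorphM /=.
rewrite lerD // (le_trans (CauchySchwarz_ip _ _)) // ?Er ?Et -?mulrA ler_wpM2l ?ler0c //.
by rewrite (le_trans (hc _)) // ler_wpM2l // ler0c.
Qed.

(** The value at [v] of the extension of [e i |-> f i] is the limit of [comb f (s n)] along
    combinations [comb e (s n)] tending to [v]. The bound against every [s] pins [w] down, which
    later yields linearity. *)
Lemma total_ext_vec (f : I -> H) (c : R) : 0 <= c ->
  (forall s, `|comb f s| <= c%:C * `|comb e s|) ->
  forall v, exists w, forall s, `|w - comb f s| <= c%:C * `|v - comb e s|.
Proof.
move=> c0 hfe v.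
have /choice [s hs] : forall n : nat, exists s, `|v - comb e s| <= (n.+1%:R^-1 : R)%:C.
  by move=> n; apply: total_approx; rewrite // invr_gt0.
have diff t t' : `|comb f t - comb f t'| <= c%:C * `|comb e t - comb e t'|.
  have E (g : I -> H) : comb g t - comb g t' =
      comb g ([seq (-1 * p.1, p.2) | p <- t'] ++ t).
    by rewrite comb_scale_cat scaleN1r addrC.
  by rewrite !E.
have key t n : `|comb f (s n) - comb f t| <=
    c%:C * `|v - comb e t| + (c * n.+1%:R^-1)%:C.
  rewrite (le_trans (diff _ _)) // rmorphM /= -mulrDr ler_wpM2l ?ler0c //.
  have -> : comb e (s n) - comb e t = (v - comb e t) - (v - comb e (s n)).
    by rewrite opprB [RHS]addrC addrA subrK.
  by rewrite (le_trans (ler_normB _ _)) // lerD.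
(* The division is by [c + 1] because [c] may be zero. *)
have small q : 0 < q -> exists N, forall n, (N <= n)%N -> c * n.+1%:R^-1 < q / 2.
  move=> q0; have c1 : 0 < c + 1 by rewrite ltr_wpDl.
  have q1 : 0 < q / 2 / (c + 1) by rewrite !divr_gt0.
  exists (Num.truncn (q / 2 / (c + 1))^-1) => n hn.
  have : (q / 2 / (c + 1))^-1 < n.+1%:R.
    by rewrite (lt_le_trans (truncnS_gt _)) // ler_nat.
  rewrite invf_plt ?posrE ?ltr0n // => h.
  rewrite (le_lt_trans (y := (c + 1) * n.+1%:R^-1)) //.
    by rewrite ler_wpM2r // lerDl.
  by rewrite mulrC -ltr_pdivlMr.
pose x n := comb f (s n).
have cx : cvg (x @ \oo).
  (* A positive element of [R[i]] has zero imaginary part, so [eps] is replaced by its real part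
     [q]. *)
  apply: cauchy_cvg; apply: cauchy_exP => eps; rewrite ltcE /= => /andP[/eqP i0 e0].
  have {i0}-> : eps = (complex.Re eps)%:C by case: (eps) i0 => a b /= ->.
  set q := complex.Re eps in e0 *.
  have [N hN] := small q e0.
  exists (x N); exists N => // n /= hn.
  rewrite -ball_normE /ball_ /= (le_lt_trans (diff _ _)) //.
  have -> : comb e (s N) - comb e (s n) = (v - comb e (s n)) - (v - comb e (s N)).
    by rewrite opprB [RHS]addrC addrA subrK.
  apply: (@le_lt_trans _ _ (c%:C * ((n.+1%:R^-1 : R)%:C + (N.+1%:R^-1 : R)%:C))).
    by rewrite ler_wpM2l ?ler0c // (le_trans (ler_normB _ _)) // lerD.
  rewrite -rmorphD -rmorphM /= ltcR mulrDr [q]splitr ltrD //; exact: hN.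
exists (lim (x @ \oo)) => t.
apply/ler_addgt0Pr => eps; rewrite ltcE /= => /andP[/eqP i0 e0].
have {i0}-> : eps = (complex.Re eps)%:C by case: (eps) i0 => a b /= ->.
set q := complex.Re eps in e0 *.
have [N hN] := small q e0.
have /cvgrPdist_lt cxl : x @ \oo --> lim (x @ \oo) by exact: cx.
have q2 : 0 < (q / 2)%:C by rewrite ltcR divr_gt0.
have [M _ hM] := cxl _ q2.
have -> : lim (x @ \oo) - comb f t =
    (lim (x @ \oo) - x (maxn M N)) + (comb f (s (maxn M N)) - comb f t).
  by rewrite addrA subrK.
apply: (@le_trans _ _ ((q / 2)%:C + (c%:C * `|v - comb e t| + (q / 2)%:C))).
  rewrite (le_trans (ler_normD _ _)) // lerD //.
    by apply: ltW; apply: hM; rewrite /= leq_maxl.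
  by rewrite (le_trans (key _ _)) // lerD // lecR ltW // hN // leq_maxr.
by rewrite addrCA -rmorphD -splitr.
Qed.

Lemma bounded_ext (f : I -> H) (c : R) : 0 <= c ->
  (forall s, `|comb f s| <= c%:C * `|comb e s|) ->
  exists2 T, bounded_op T & forall i, T (e i) = f i.
Proof.
move=> c0 hfe.
have /choice [T hT] := total_ext_vec c0 hfe.
have bnd v : `|T v| <= c%:C * `|v|.
  (* The empty combination gives the operator bound; below, a one-term combination is at distance
     zero from [e i] and gives [T (e i) = f i]. *)
  by have := hT v [::]; rewrite /comb !big_nil !subr0.
exists T; last first.
  move=> i; have := hT (e i) [:: (1, i)].
  rewrite /comb !big_seq1 !scale1r subrr normr0 mulr0 normr_le0 subr_eq0.
  by move/eqP.
split; last by exists c.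
move=> a u v; apply/subr0_eq.
have [r Er] : exists r, `|a| = r%:C.
  by apply/complex_realP; apply: normr_real.
apply: (@norm_le_eps_eq0 _ (c * (r + 1) * 2)) => eps e0.
have [s hs] := total_approx te u e0; have [t ht] := total_approx te v e0.
(* If [s] and [t] approximate [u] and [v], then [w] approximates [a *: u + v]; each of the two
   resulting errors is at most [c * (r + 1) * eps]. *)
pose w := [seq (a * p.1, p.2) | p <- s] ++ t.
have cE (g : I -> H) : comb g w = a *: comb g s + comb g t.
  exact: comb_scale_cat.
have -> : T (a *: u + v) - (a *: T u + T v) = (T (a *: u + v) - comb f w) -
   (a *: (T u - comb f s) + (T v - comb f t)).
  rewrite cE scalerBr; move: (T (_ + _)) (a *: T u) (T v) (a *: comb f s) (comb f t).
  move=> x1 x2 x3 x4 x5; rewrite [x2 - x4 + _]addrACA [- (_ + (- _ - _))]opprD.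
  by rewrite -[- x4 - x5]opprD opprK addrACA addNr addr0.
have b2 : `|a *: (T u - comb f s) + (T v - comb f t)| <= (c * (r + 1) * eps)%:C.
  rewrite (le_trans (ler_normD _ _)) // normrZ Er mulrDr mulr1 mulrDl rmorphD.
  rewrite lerD //; last by rewrite (le_trans (hT _ _)) // rmorphM ler_wpM2l ?ler0c.
  rewrite (mulrC c) -mulrA rmorphM ler_wpM2l -?Er // rmorphM (le_trans (hT _ _)) //.
  by rewrite ler_wpM2l ?ler0c.
have b1 : `|T (a *: u + v) - comb f w| <= (c * (r + 1) * eps)%:C.
  rewrite (le_trans (hT _ _)) // -mulrA rmorphM ler_wpM2l ?ler0c // cE.
  rewrite opprD addrACA -scalerBr (le_trans (ler_normD _ _)) // normrZ Er.
  by rewrite mulrDl mul1r rmorphD rmorphM lerD // ler_wpM2l -?Er.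
rewrite (le_trans (ler_normB _ _)) //.
have -> : c * (r + 1) * 2 * eps = c * (r + 1) * eps + c * (r + 1) * eps by ring.
by rewrite rmorphD lerD.
Qed.

(** Proportional Gram matrices give [|comb f s| = c |comb e s|], so the extension is [c] times an
    isometry. Creation operators and the flip are both built this way. *)
Lemma gram_ext (f : I -> H) (c : R) : 0 <= c ->
  (forall i j, ip (f i) (f j) = (c ^+ 2)%:C * ip (e i) (e j)) ->
  exists2 T, bounded_op T & forall i, T (e i) = f i.
Proof.
move=> c0 h; apply: (bounded_ext c0) => s.
rewrite -(@ler_pXn2r _ 2) ?nnegrE ?mulr_ge0 ?ler0c //.
rewrite exprMn -!ip_self -rmorphXn /= !ip_combl mulr_sumr le_eqVlt.
apply/orP; left; apply/eqP; apply: eq_bigr => p _.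
rewrite !ip_combr !mulr_sumr; apply: eq_bigr => q _.
by rewrite h; ring.
Qed.

(** The values [f i] expected of the adjoint extend boundedly: for y = [comb f s], |y|^2 = <comb e
    s, T y> is at most c |comb e s| |y|. The adjoint thus exists, so [adj] does not take its default
    value. *)
Lemma adjoint_ext T (f : I -> H) : bounded_op T ->
  (forall i j, ip (f i) (e j) = ip (e i) (T (e j))) ->
  [/\ bounded_op (adj T), forall u v, ip (T u) v = ip u (adj T v) &
      forall i, adj T (e i) = f i].
Proof.
move=> bT h; have [c c0 hc] := bounded_op_ge0 bT.
have hw i w : ip (f i) w = ip (e i) (T w) by apply: ip_total_eq.
have [|T' bT' eT'] := @bounded_ext f c c0.
  move=> s; have [->|n0] := eqVneq (comb f s) 0; first by rewrite normr0 mulr_ge0 ?ler0c.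
  have n1 : 0 < `|comb f s| by rewrite normr_gt0.
  rewrite -(ler_pM2r n1) -expr2 -ip_self.
  have -> : ip (comb f s) (comb f s) = ip (comb e s) (T (comb f s)).
    by rewrite [LHS]ip_combl ip_combl; apply: eq_bigr => p _; rewrite hw.
  have g0 : 0 <= ip (comb e s) (T (comb f s)).
    rewrite ip_combl (eq_bigr (fun p => p.1 * ip (f p.2) (comb f s))).
      by rewrite -ip_combl ip_self exprn_ge0.
    by move=> p _; rewrite hw.
  rewrite -(ger0_norm g0) (le_trans (CauchySchwarz_ip _ _)) //.
  by rewrite [c%:C * _]mulrC -mulrA ler_wpM2l.
have adjE u v : ip (T u) v = ip u (T' v).
  by apply: ip_total_eq => // i; rewrite eT' ipC [RHS]ipC hw.
have [bA aA] : [set T' : H -> H | bounded_op T' /\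
    forall u v : H, ip (T u) v = ip u (T' v)] (adj T).
  by apply: xgetPex; exists T'.
split=> // i; apply/subr0_eq/ip_self_eq0.
by rewrite ipBr -aA adjE eT' subrr.
Qed.

End Total.
End Hilbert.

(** * Commutants of self-adjoint families, and Bessel's inequality *)

Section Commutant.
Variables (R : realType) (H : hilbert R).

(** Self-adjointness of the members of [P] makes the commutant stable under adjoints. It is weakly
    closed because commutation with [S] is tested on matrix coefficients. *)
Lemma commutant_von_neumann (P : set (H -> H)) :
  (forall S, P S -> bounded_op S /\ forall u v : H, ip (S u) v = ip u (S v)) ->
  von_neumann_algebra [set T | bounded_op T /\ forall S, P S -> T \o S = S \o T].
Proof.
move=> hP; split; first split.
- by move=> T [].
- by split; [exact: bounded_idfun | ].
- move=> a X Y [bX cX] [bY cY]; split; first exact: bounded_scaleD.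
  move=> S PS; have [bS _] := hP S PS; apply/funext => v.
  change (a *: X (S v) + Y (S v) = S (a *: X v + Y v)).
  rewrite (boundedP _ _ _ bS); congr (_ *: _ + _).
    exact: (congr1 (fun f => f v) (cX S PS)).
  exact: (congr1 (fun f => f v) (cY S PS)).
- move=> X Y [bX cX] [bY cY]; split; first exact: bounded_comp.
  by move=> S PS; rewrite -compA cY // compA cX.
- move=> X [bX cX].
  have [ex|nex] := pselect ([set T' : H -> H | bounded_op T' /\
      forall u v : H, ip (X u) v = ip u (T' v)] !=set0); last first.
    (* [adj X] is then the default value 0, which commutes with everything. *)
    rewrite /adj xgetPN; last by move=> T' hT'; apply: nex; exists T'.
    split; first exact: bounded_zero.
    by move=> S PS; have [bS _] := hP S PS; apply/funext => v; rewrite /= bounded0.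
  have [bA aA] := xgetPex 0 ex; rewrite -/(adj X) in bA aA.
  split=> // S PS; have [bS sS] := hP S PS.
  apply/funext => v /=; apply/subr0_eq/ip_self_eq0; rewrite ipBr -aA -!sS -aA.
  have cXE u : X (S u) = S (X u) := congr1 (fun f => f u) (cX S PS).
  by rewrite cXE subrr.
- move=> T bT hT; split=> // S PS; have [bS sS] := hP S PS.
  apply/funext => v /=; apply/subr0_eq/ip_self_eq0.
  set w := T (S v) - S (T v).
  apply: (@norm_le_eps_eq0 _ _ 2) => eps e0.
  (* Since [X] commutes with [S], <w, w> is the difference of the coefficients of T - X at (S v, w)
     and (v, S w), so two test pairs suffice. *)
  have [X [bX cX] hX] := hT [:: (S v, w); (v, S w)] eps e0.
  have cXE : X (S v) = S (X v) := congr1 (fun f => f v) (cX S PS).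
  have -> : ip w w = ip (T (S v) - X (S v)) w - ip (T v - X v) (S w).
    by rewrite {1}/w !ipBl -!sS cXE; ring.
  rewrite (le_trans (ler_normB _ _)) // mulr_natl mulr2n rmorphD /= lerD // ltW //.
    by apply: (hX (S v, w)); rewrite mem_head.
  by apply: (hX (v, S w)); rewrite !inE eqxx orbT.
Qed.

Lemma bessel (y : nat -> H) (x : H) n :
  (forall i j, i != j -> ip (y i) (y j) = 0) ->
  (forall i, ip x (y i) = ip (y i) (y i)) ->
  \sum_(i < n) `|y i| ^+ 2 <= `|x| ^+ 2.
Proof.
move=> oy xy.
suff -> : \sum_(i < n) `|y i| ^+ 2 = `|x| ^+ 2 - `|x - \sum_(i < n) y i| ^+ 2.
  by rewrite gerBl exprn_ge0.
elim: n => [|n ih]; first by rewrite !big_ord0 subr0 subrr.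
rewrite !big_ord_recr /= ih opprD addrA.
have o : ip (x - \sum_(i < n) y i) (y n) = ip (y n) (y n).
  rewrite ipBl xy (_ : ip (\sum_(i < n) y i) (y n) = 0) ?subr0 //.
  rewrite /ip linear_sumlz big1 //= => i _; apply: oy.
  by rewrite neq_ltn ltn_ord.
move: (x - _) o => u o.
by rewrite -(ip_self (u - y n)) ipBl !ipBr o (ipC (y n) u) o -ipC !ip_self; ring.
Qed.
End Commutant.

(** * Real and complex square-integrable functions *)

Section L2.
Variable R : realType.
Implicit Types (f g h k : R -> R) (u v : R -> R[i]).

Definition cplx h : R -> R[i] := fun t => (h t)%:C.

Lemma L2R_mul_integrable f g : L2R f -> L2R g ->
  (lebRp R).-integrable setT (EFin \o (fun t => f t * g t)).
Proof.
move=> hf hg; apply/Lfun1_integrable.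
exact: (Lfun2_mul_Lfun1 hf hg).
Qed.

Lemma L2R_Nmul_integrable f g : L2R f -> L2R g ->
  (lebRp R).-integrable setT (EFin \o (fun t => - (f t * g t))).
Proof.
move=> hf hg.
suff -> : EFin \o (fun t => - (f t * g t)) = (\- (EFin \o (fun t => (f t * g t)%R)))%E.
  by apply: integrableN; exact: L2R_mul_integrable.
by apply/funext.
Qed.

Lemma L2C_cplx h : L2R h -> L2C (cplx h).
Proof.
move=> hh; split; first exact: hh.
rewrite /L2R /=.
have := @Lfun_scale _ _ _ (lebRp R) h 0 2 _ hh.
rewrite ler1n => /(_ isT).
suff -> : 0 \o* h = (fun t => complex.Im (cplx h t)) by [].
by apply/funext => t /=; rewrite mulr0.
Qed.

(** Symmetry for real functions is what makes left and right field operators commute on the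
    vacuum. *)
Lemma dotL2_cplxC h k : dotL2 (cplx h) (cplx k) = dotL2 (cplx k) (cplx h).
Proof.
rewrite /dotL2; congr Complex; apply: eq_Rintegral => t _;
  by rewrite /cplx /= !(mulr0, mul0r, oppr0, addr0) // mulrC.
Qed.

(** As [dotL2] integrates real and imaginary parts separately, linearity requires the integrability
    of four real products, each a product of two L^2 functions. *)
Lemma dotL2_ReIm u v : L2C u -> L2C v ->
  dotL2 u v = dotL2 (cplx (fun t => complex.Re (u t))) v
    + 'i * dotL2 (cplx (fun t => complex.Im (u t))) v.
Proof.
move=> [ru iu] [rv iv]; rewrite /dotL2 /cplx.
set A := (X in (X +i* _) = _); set B := (X in _ +i* X = _).
set C1 := (X in _ = (X +i* _) + _); set C2 := (X in _ = (_ +i* X) + _).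
set D1 := (X in _ = _ + 'i * (X +i* _)); set D2 := (X in _ = _ + 'i * (_ +i* X)).
have -> : 'i * (D1 +i* D2) = (- D2) +i* D1.
  by apply/eqP; rewrite eq_complex /= !mul0r !mul1r sub0r add0r !eqxx.
suff [-> ->] : A = C1 - D2 /\ B = C2 + D1 by [].
split.
- rewrite /A /C1 /D2 -RintegralB //=.
  + by apply: eq_Rintegral => t _; case: (u t) (v t) => [a b] [c d] /=; ring.
  + rewrite (_ : _ \o _ = EFin \o (fun t => complex.Re (u t) * complex.Re (v t))).
      exact: L2R_mul_integrable.
    by apply/funext => t /=; case: (u t) (v t) => [a b] [c d] /=; congr EFin; ring.
  + rewrite (_ : _ \o _ = EFin \o (fun t => - (complex.Im (u t) * complex.Im (v t)))).
      exact: L2R_Nmul_integrable.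
    by apply/funext => t /=; case: (u t) (v t) => [a b] [c d] /=; congr EFin; ring.
- rewrite /B /C2 /D1 -RintegralD //=.
  + by apply: eq_Rintegral => t _; case: (u t) (v t) => [a b] [c d] /=; ring.
  + rewrite (_ : _ \o _ = EFin \o (fun t => - (complex.Re (u t) * complex.Im (v t)))).
      exact: L2R_Nmul_integrable.
    by apply/funext => t /=; case: (u t) (v t) => [a b] [c d] /=; congr EFin; ring.
  + rewrite (_ : _ \o _ = EFin \o (fun t => complex.Im (u t) * complex.Re (v t))).
      exact: L2R_mul_integrable.
    by apply/funext => t /=; case: (u t) (v t) => [a b] [c d] /=; congr EFin; ring.
Qed.

(** The orthonormal sequence to which Bessel's inequality will be applied; half-open intervals make
    the supports disjoint. *)
Definition unit_bump (n : nat) : R -> R := \1_`[n%:R, n.+1%:R[%classic.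

Lemma lebRp_bump n : lebRp R `[n%:R, n.+1%:R[%classic = 1%E.
Proof.
rewrite /lebRp /= /mrestr setIidl.
  rewrite lebesgue_measure_itv /= lte_fin ltr_nat ltnSn -EFinB.
  by rewrite -natrB // subSnn.
by move=> t /=; rewrite !in_itv /= andbT => /andP[nt _]; rewrite (le_trans _ nt).
Qed.

Lemma L2R_unit_bump n : L2R (unit_bump n).
Proof.
have mB : measurable (`[n%:R, n.+1%:R[%classic : set R) by exact: measurable_itv.
rewrite /L2R /=; apply/andP; split.
  by rewrite inE /=; exact: measurable_realfun.measurable_indic.
rewrite inE /= /finite_norm unlock poweR_lty //.
under eq_integral => x _.
  rewrite (_ : (_ `^ _)%E = (\1_`[n%:R, n.+1%:R[%classic x)%:E); last first.
    rewrite /= /unit_bump indicE; case: (_ \in _).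
      by rewrite mulr1n normr1 powR1.
    by rewrite mulr0n normr0 powR0.
  over.
by rewrite integral_indic // setIT lebRp_bump ltry.
Qed.

Lemma dotL2_unit_bump m n :
  dotL2 (cplx (unit_bump m)) (cplx (unit_bump n)) = (m == n)%:R.
Proof.
have mB p : measurable (`[p%:R, p.+1%:R[%classic : set R) by exact: measurable_itv.
rewrite /dotL2 /cplx.
have -> : \int[lebRp R]_t complex.Im ((unit_bump m t)%:C * ((unit_bump n t)%:C)^*) = 0.
  rewrite /Rintegral integral0_eq // => t _ /=.
  by rewrite oppr0 mulr0 mul0r addr0.
rewrite complexr0.
have -> : \int[lebRp R]_t complex.Re ((unit_bump m t)%:C * ((unit_bump n t)%:C)^*) =
   \int[lebRp R]_t \1_(`[m%:R, m.+1%:R[%classic `&` `[n%:R, n.+1%:R[%classic) t.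
  apply: eq_Rintegral => t _ /=; rewrite oppr0 mulr0 subr0.
  by rewrite /unit_bump !indicE in_setI -natrM mulnb.
rewrite /Rintegral integral_indic //; last exact: measurableI.
rewrite setIT; have [->|mn] := eqVneq m n.
  by rewrite setIid lebRp_bump.
suff -> : (`[m%:R, m.+1%:R[%classic `&` `[n%:R, n.+1%:R[%classic : set R) = set0.
  by rewrite measure0.
apply/seteqP; split=> // t /=; rewrite !in_itv /= => -[/andP[a b] /andP[c d]].
have := le_lt_trans a d; have := le_lt_trans c b; rewrite !ltr_nat !ltnS => h1 h2.
by move: mn; rewrite eqn_leq h1 h2.
Qed.
End L2.

(** * Operators on the full Fock space *)

Section Fock.
Variables (R : realType) (K : fock R).
Implicit Types (f g h : R -> R[i]) (fs gs : seq (R -> R[i])).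

(** The Gram formula constrains [tens] only on lists of L^2 functions, so the total family is
    indexed by this subtype. *)
Let I := {gs : seq (R -> R[i]) | L2seq gs}.
Let e (i : I) : K := tens K (sval i).

Let te : Defs.total (range e).
Proof.
rewrite /Defs.total -(total_tens K); congr (closure (linspan _)).
apply/seteqP; split => [_ [[gs hgs] _ <-]|_ [gs hgs <-]]; first by exists gs.
by exists (exist _ gs hgs).
Qed.

Lemma L2seq_cons g gs : L2seq (g :: gs) <-> L2C g /\ L2seq gs.
Proof.
split=> [h|[hg hgs] x].
  by split=> [|x xgs]; apply: h; rewrite inE ?eqxx ?xgs ?orbT.
by rewrite inE => /orP[/eqP ->//|]; exact: hgs.
Qed.

Lemma L2seq_rev gs : L2seq (rev gs) <-> L2seq gs.
Proof. by split=> h x hx; apply: h; rewrite ?mem_rev // -mem_rev. Qed.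

Lemma L2seq_rcons g gs : L2seq (rcons gs g) <-> L2C g /\ L2seq gs.
Proof. by rewrite -L2seq_rev rev_rcons L2seq_cons L2seq_rev. Qed.

Lemma tens_eq (T T' : K -> K) : bounded_op T -> bounded_op T' ->
  (forall gs, L2seq gs -> T (tens K gs) = T' (tens K gs)) -> T = T'.
Proof. by move=> bT bT' h; apply: (bounded_eq te bT bT') => -[gs hgs]; exact: h. Qed.

Lemma tens_ext_vec (x y : K) :
  (forall gs, L2seq gs -> ip x (tens K gs) = ip y (tens K gs)) -> x = y.
Proof.
move=> h; apply/subr0_eq/ip_self_eq0; rewrite ipBl.
rewrite (@ip_total_eq _ _ _ _ te idfun x y (bounded_idfun _)) ?subrr //.
by move=> [gs hgs]; exact: h.
Qed.

Lemma ip_tens_nil gs : L2seq gs -> ip (tens K gs) (vacuum K) = (nilp gs)%:R.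
Proof.
by move=> hgs; rewrite dot_tens // /nilp; case: gs hgs => //= _; rewrite big_nil.
Qed.

Lemma ip_tens_cons f fs g gs : L2seq (f :: fs) -> L2seq (g :: gs) ->
  ip (tens K (f :: fs)) (tens K (g :: gs)) =
  dotL2 f g * ip (tens K fs) (tens K gs).
Proof.
move=> hf hg; rewrite dot_tens // => /=; have [_ hfs] := (L2seq_cons _ _).1 hf.
have [_ hgs] := (L2seq_cons _ _).1 hg; rewrite dot_tens // eqSS.
by case: ifP; rewrite ?mulr0 // big_cons.
Qed.

Lemma ip_tens_size fs gs : L2seq fs -> L2seq gs -> size fs != size gs ->
  ip (tens K fs) (tens K gs) = 0.
Proof. by move=> hf hg /negbTE E; rewrite dot_tens // E. Qed.

Lemma ip_vacuum : ip (vacuum K) (vacuum K) = 1.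
Proof. by rewrite ip_tens_nil. Qed.

Lemma dotL2_ip f g : L2C f -> L2C g -> dotL2 f g = ip (tens K [:: f]) (tens K [:: g]).
Proof.
move=> hf hg; rewrite ip_tens_cons ?ip_vacuum ?mulr1 // ; by apply/L2seq_cons.
Qed.

(** * Creation, annihilation and flip on simple tensors *)

Definition ann_tens h gs : K :=
  if gs is g :: gs' then dotL2 g h *: tens K gs' else 0.

(** Prepending [h] multiplies the Gram matrix by <h, h>, so [gram_ext] applies with [c] the norm of
    [h], and [creation] does not take its default value. *)
Lemma creationP h : L2C h -> bounded_op (creation K h) /\
  forall gs, L2seq gs -> creation K h (tens K gs) = tens K (h :: gs).
Proof.
move=> hh.
apply: (@xgetPex _ 0 [set L : K -> K | bounded_op L /\
    forall gs, L2seq gs -> L (tens K gs) = tens K (h :: gs)]).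
have [c Ec] : exists c, `|tens K [:: h]| = c%:C.
  by apply/complex_realP; apply: normr_real.
have c0 : 0 <= c by rewrite -ler0c -Ec.
have [|T bT hT] := @gram_ext _ _ _ _ te (fun i => tens K (h :: sval i)) c c0.
  move=> [fs hfs] [gs hgs] /=; rewrite ip_tens_cons ?dotL2_ip //; try by apply/L2seq_cons.
  by rewrite ip_self Ec -rmorphXn.
by exists T; split=> // gs hgs; exact: (hT (exist _ gs hgs)).
Qed.

(** The formula [ann_tens] is dual to prepending [h]: it strips the first letter, and gives 0 on the
    vacuum because the vacuum is orthogonal to every longer tensor. *)
Lemma annihilationP h : L2C h ->
  [/\ bounded_op (adj (creation K h)),
      forall u v, ip (creation K h u) v = ip u (adj (creation K h) v) &
      forall gs, L2seq gs -> adj (creation K h) (tens K gs) = ann_tens h gs].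
Proof.
move=> hh; have [bL hL] := creationP hh.
have [|bA aA hA] := @adjoint_ext _ _ _ _ te _ (fun i => ann_tens h (sval i)) bL.
  move=> [fs hfs] [gs hgs] /=; rewrite hL //.
  have hhgs : L2seq (h :: gs) by apply/L2seq_cons.
  case: fs hfs => [|f fs] hfs; first by rewrite ip0l ip_tens_size.
  by rewrite ip_tens_cons //= ipZl.
by split=> // gs hgs; exact: (hA (exist _ gs hgs)).
Qed.

(** Reversing both lists only permutes the factors of the Gram product, so the flip is isometric;
    being an involution, it is also self-adjoint. *)
Lemma flip_exists : exists W : K -> K,
  [/\ bounded_op W, forall gs, L2seq gs -> W (tens K gs) = tens K (rev gs),
      forall u v, ip (W u) v = ip u (W v) & W \o W = idfun].
Proof.
have revE fs gs : L2seq fs -> L2seq gs ->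
    ip (tens K (rev fs)) (tens K (rev gs)) = ip (tens K fs) (tens K gs).
  move=> hf hg; rewrite !dot_tens ?L2seq_rev //; try exact/L2seq_rev.
  rewrite !size_rev; case: eqP => // sE.
  by rewrite -rev_zip // (perm_big (zip fs gs)) // perm_rev.
have [|W bW hW] := @gram_ext _ _ _ _ te (fun i => tens K (rev (sval i))) 1 ler01.
  by move=> [fs hfs] [gs hgs] /=; rewrite expr1n mul1r revE.
have W1 gs : L2seq gs -> W (tens K gs) = tens K (rev gs).
  by move=> hgs; exact: (hW (exist _ gs hgs)).
have WW : W \o W = idfun.
  apply: tens_eq; [exact: bounded_comp | exact: bounded_idfun |].
  by move=> gs hgs /=; rewrite !W1 ?revK //; exact/L2seq_rev.
exists W; split=> // u v; apply: (ip_total_eq te bW) => -[gs hgs].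
rewrite ipC [RHS]ipC; congr Num.conj; apply/esym.
apply: (ip_total_eq te bW) => -[fs hfs]; rewrite /e /= !W1 //.
by rewrite -[in RHS](revK gs) revE //; exact/L2seq_rev.
Qed.

Lemma creation_bounded h : L2C h -> bounded_op (creation K h).
Proof. by case/creationP. Qed.

Lemma creation_tens h gs : L2C h -> L2seq gs ->
  creation K h (tens K gs) = tens K (h :: gs).
Proof. by move=> hh; exact: (creationP hh).2. Qed.

Lemma ip_creation h u v : L2C h ->
  ip (creation K h u) v = ip u (adj (creation K h) v).
Proof. by case/annihilationP => _ + _; exact. Qed.

(** The annihilator strips the letter just added. Hence creation by a unit vector is isometric, and
    creations by orthogonal vectors have orthogonal ranges. *)
Lemma annihilation_creation f h : L2C f -> L2C h ->
  adj (creation K f) \o creation K h = dotL2 h f *: (idfun : K -> K).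
Proof.
move=> hf hh; have [bA _ tA] := annihilationP hf.
have bid := bounded_idfun K.
apply: tens_eq.
- exact: bounded_comp (creation_bounded hh).
- by rewrite -[_ *: _]addr0; apply: bounded_scaleD => //; exact: bounded_zero.
by move=> gs hgs /=; rewrite creation_tens // tA //; apply/L2seq_cons.
Qed.

Lemma norm_creation h u : L2C h -> dotL2 h h = 1 -> `|creation K h u| = `|u|.
Proof.
move=> hh h1; apply/eqP; rewrite -(@eqrXn2 _ 2) // -!ip_self ip_creation //.
have /(congr1 (fun T => T u)) /= -> := annihilation_creation hh hh.
by rewrite h1 [(1 *: _) u]scale1r.
Qed.

Local Arguments field_op : simpl never.

(** * Left field operators *)

Section Field.
Variable h : R -> R.
Hypothesis hh : L2R h.
Let ch := L2C_cplx hh.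

Lemma field_bounded : bounded_op (field_op K h).
Proof.
have [bA _ _] := annihilationP ch.
by apply: bounded_add => //; exact: creation_bounded.
Qed.

Lemma ip_field u v : ip (field_op K h u) v = ip u (field_op K h v).
Proof.
have [_ aA _] := annihilationP ch.
rewrite /field_op /= ipDl [X in _ = ip u X]/(_ + _) ipDr aA addrC; congr (_ + _).
by rewrite ipC -aA -ipC.
Qed.

Lemma field_tens gs : L2seq gs ->
  field_op K h (tens K gs) = tens K (cplx h :: gs) + ann_tens (cplx h) gs.
Proof.
move=> hgs; have [_ _ tA] := annihilationP ch.
by rewrite -(creation_tens ch hgs) -tA.
Qed.
End Field.

(** * Right field operators and the estimate for vectors on which both fields agree *)

Section Flip.
Variable W : K -> K.
Hypothesis bW : bounded_op W.
Hypothesis tW : forall gs, L2seq gs -> W (tens K gs) = tens K (rev gs).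
Hypothesis aW : forall u v, ip (W u) v = ip u (W v).
Hypothesis WW : W \o W = idfun.

Lemma flipK u : W (W u) = u.
Proof. by rewrite -[LHS]/((W \o W) u) WW. Qed.

Lemma flip_norm u : `|W u| = `|u|.
Proof. by apply/eqP; rewrite -(@eqrXn2 _ 2) // -!ip_self aW flipK. Qed.

Lemma flip_vacuum : W (vacuum K) = vacuum K.
Proof. by rewrite tW. Qed.

Definition right_field (h : R -> R) : K -> K := W \o field_op K h \o W.

Local Arguments right_field : simpl never.

Lemma right_field_bounded (h : R -> R) : L2R h -> bounded_op (right_field h).
Proof.
by move=> hh; apply: bounded_comp => //; apply: bounded_comp => //; exact: field_bounded.
Qed.

Lemma ip_right_field (h : R -> R) u v : L2R h -> ip (right_field h u) v = ip u (right_field h v).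
Proof. by move=> hh; rewrite /right_field /= aW ip_field // aW. Qed.

Lemma right_field_nil (h : R -> R) : L2R h -> right_field h (vacuum K) = tens K [:: cplx h].
Proof.
move=> hh; rewrite /right_field /= flip_vacuum field_tens //= addr0 tW //.
by apply/L2seq_cons; split=> //; exact: L2C_cplx.
Qed.

Lemma right_field_rcons (h : R -> R) gs g : L2R h -> L2seq (rcons gs g) ->
  right_field h (tens K (rcons gs g)) =
  tens K (rcons (rcons gs g) (cplx h)) + dotL2 g (cplx h) *: tens K gs.
Proof.
move=> hh hgs; have ch := L2C_cplx hh; have [hg hgs'] := (L2seq_rcons _ _).1 hgs.
rewrite /right_field /= tW // rev_rcons field_tens //=; last by apply/L2seq_cons; rewrite L2seq_rev.
rewrite boundedD // boundedZ // !tW ?L2seq_rev //.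
  by rewrite !rev_cons revK.
by apply/L2seq_cons; split=> //; apply/L2seq_cons; rewrite L2seq_rev.
Qed.

(** The left field acts on the first letter and the right field on the last, so only short tensors
    need care. On the vacuum the scalars <k, h> and <h, k> must agree; on a single letter either
    side may remove it, and both orders give the same two terms. *)
Lemma field_right_comm (h : R -> R) (k : R -> R) : L2R h -> L2R k ->
  field_op K h \o right_field k = right_field k \o field_op K h.
Proof.
move=> hh hk; have ch := L2C_cplx hh; have ck := L2C_cplx hk.
have bS := field_bounded hh; have bR := right_field_bounded hk.
apply: tens_eq; [exact: bounded_comp | exact: bounded_comp |].
move=> gs.
change (L2seq gs -> field_op K h (right_field k (tens K gs)) =
  right_field k (field_op K h (tens K gs))).
have l1 f : L2C f -> L2seq [:: f] by move=> hf; apply/L2seq_cons.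
have l2 f g fs : L2C f -> L2seq (g :: fs) -> L2seq [:: f, g & fs].
  by move=> hf hg; apply/L2seq_cons.
case: gs => [|g gs] hgs.
  rewrite right_field_nil // !field_tens //=; last exact: l1.
  rewrite addr0 (right_field_rcons (gs := [::]) hk) /=; last exact: l1.
  by rewrite dotL2_cplxC.
have [hg] := (L2seq_cons _ _).1 hgs.
case/lastP: gs hgs => [|gs g'] hgs hgs'.
  have hg0 : L2seq [:: g] by [].
  rewrite (right_field_rcons (gs := [::]) hk) //= boundedD // boundedZ //.
  rewrite !field_tens //=; last by apply/L2seq_cons; split=> //; exact: l1.
  rewrite addr0 (boundedD _ _ bR) (boundedZ _ _ bR) right_field_nil //.
  rewrite (right_field_rcons (gs := [:: cplx h]) hk) /=; last exact: l2.
  by rewrite addrAC.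
have [hg' hgs''] := (L2seq_rcons _ _).1 hgs'.
rewrite -rcons_cons right_field_rcons ?rcons_cons // boundedD // boundedZ //.
rewrite !field_tens //=.
- rewrite (boundedD _ _ bR) (boundedZ _ _ bR) -!rcons_cons !right_field_rcons //=.
    by rewrite !scalerDr !scalerA addrACA [dotL2 g _ * _]mulrC addrACA.
  exact: l2.
- by apply/L2seq_cons.
- apply/L2seq_cons; split=> //; apply/L2seq_rcons; split=> //.
Qed.

(** The commutant of the right fields is a von Neumann algebra containing the left fields, so it
    contains [SC], the smallest one. *)
Lemma SC_commutes_right F (h : R -> R) : SC F -> L2R h ->
  bounded_op F /\ F \o right_field h = right_field h \o F.
Proof.
move=> hF hh.
have [] : [set T | bounded_op T /\ forall S, (right_field @` @L2R R) S ->
    T \o S = S \o T] F.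
  apply: hF; split.
    apply: commutant_von_neumann => _ [k hk <-]; split.
      exact: right_field_bounded.
    by move=> u v; exact: ip_right_field.
  move=> _ [k hk <-]; split; first exact: field_bounded.
  by move=> _ [k' hk' <-]; exact: field_right_comm.
by move=> bF; move/(_ (right_field h)) => c; split=> //; apply: c; exists h.
Qed.

(** Removing a letter on the left commutes with adding one on the right, except on the vacuum, where
    the letter just added is removed; this produces the rank-one term. *)
Lemma annihilation_right h : L2C h ->
  adj (creation K h) \o (W \o creation K h \o W) =
  (W \o creation K h \o W) \o adj (creation K h)
  + (fun u => ip u (vacuum K) *: (dotL2 h h *: vacuum K)).
Proof.
move=> hh; have bL := creation_bounded hh; have [bA _ tA] := annihilationP hh.
have bR : bounded_op (W \o creation K h \o W).
  by apply: bounded_comp => //; exact: bounded_comp.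
have tR gs : L2seq gs -> (W \o creation K h \o W) (tens K gs) = tens K (rcons gs h).
  move=> hgs; have hr : L2seq (rev gs) by apply/L2seq_rev.
  rewrite /= tW // creation_tens // tW ?rev_cons ?revK //.
  by apply/L2seq_cons.
apply: tens_eq; first exact: bounded_comp.
  by apply: bounded_add; [exact: bounded_comp | exact: rank_one_bounded].
move=> gs hgs; move: (W \o creation K h \o W) bR tR => r bR tR.
change (adj (creation K h) (r (tens K gs)) = r (adj (creation K h) (tens K gs)) +
  ip (tens K gs) (vacuum K) *: (dotL2 h h *: vacuum K)).
rewrite tR // !tA //; last by apply/L2seq_rcons.
rewrite ip_tens_nil //; case: gs hgs => [|g gs] hgs /=.
  by rewrite bounded0 // add0r scale1r.
have [_ hgs'] := (L2seq_cons _ _).1 hgs.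
by rewrite (boundedZ _ _ bR) tR // scale0r addr0.
Qed.

(** Write l for creation and r = W l W. Pairing l x - r x = r* x - l* x with l x gives |x|^2 = <r* x
    - l* x, l x> + <r x, l x>. As x is orthogonal to the vacuum, the rank-one term above vanishes
    and the last product involves only l* x and l* (W x). Cauchy-Schwarz concludes. *)
Lemma central_norm_le (h : R -> R) (x : K) : L2R h ->
  dotL2 (cplx h) (cplx h) = 1 -> ip x (vacuum K) = 0 ->
  field_op K h x = right_field h x ->
  `|x| ^+ 2 <= `|adj (creation K (cplx h)) x| * `|adj (creation K (cplx h)) (W x)|
    + (`|adj (creation K (cplx h)) x| + `|adj (creation K (cplx h)) (W x)|) * `|x|.
Proof.
move=> hh h1 x0 hx; have ch := L2C_cplx hh.
have bL := creation_bounded ch; have [bA aA tA] := annihilationP ch.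
set l := creation K (cplx h) in bL bA aA tA *; set a := adj l in bA aA tA *.
have E : l x - W (l (W x)) = W (a (W x)) - a x.
  have : l x + a x = W (l (W x)) + W (a (W x)).
    by rewrite -boundedD.
  move/(congr1 (fun y => y - a x - W (l (W x)))); rewrite addrK => ->.
  by rewrite addrC !addrA addNr add0r.
have E2 : ip (W (l (W x))) (l x) = ip (W (a x)) (a (W x)).
  rewrite ipC aA -ipC.
  have -> : a (W (l (W x))) = W (l (W (a x))) + ip x (vacuum K) *:
      (dotL2 (cplx h) (cplx h) *: vacuum K).
    exact: (congr1 (fun T : K -> K => T x) (annihilation_right ch)).
  by rewrite x0 scale0r addr0 aW aA.
have -> : `|x| ^+ 2 = ip (W (a (W x)) - a x) (l x) + ip (W (a x)) (a (W x)).
  by rewrite -E ipBl E2 subrK ip_self norm_creation.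
have s0 : 0 <= ip (W (a (W x)) - a x) (l x) + ip (W (a x)) (a (W x)).
  by rewrite -E ipBl E2 subrK ip_self exprn_ge0.
rewrite -(ger0_norm s0) (le_trans (ler_normD _ _)) // addrC lerD //.
  by rewrite (le_trans (CauchySchwarz_ip _ _)) // flip_norm.
rewrite (le_trans (CauchySchwarz_ip _ _)) // norm_creation // ler_wpM2r //.
by rewrite (le_trans (ler_normB _ _)) // flip_norm addrC.
Qed.

(** The operators l(h_i) l(h_i)* are projections with mutually orthogonal ranges, and l(h_i)
    preserves the norm of l(h_i)* x. *)
Lemma annihilation_bessel (h : nat -> R -> R[i]) (x : K) n :
  (forall i, L2C (h i)) -> (forall i j, dotL2 (h i) (h j) = (i == j)%:R) ->
  \sum_(i < n) `|adj (creation K (h i)) x| ^+ 2 <= `|x| ^+ 2.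
Proof.
move=> ch oh; pose y i := creation K (h i) (adj (creation K (h i)) x).
have yE i : `|y i| = `|adj (creation K (h i)) x|.
  by apply: norm_creation => //; rewrite oh eqxx.
rewrite (eq_bigr (fun i : 'I_n => `|y i| ^+ 2)); last by move=> i _; rewrite yE.
have xy u i : ip u (y i) = ip (adj (creation K (h i)) u) (adj (creation K (h i)) x).
  by rewrite ipC ip_creation // -ipC.
apply: bessel => [i j ij|i]; last by rewrite xy ip_self -yE -ip_self.
rewrite xy /y.
set u := adj _ x.
have -> : adj (creation K (h j)) (creation K (h i) u) = dotL2 (h i) (h j) *: u.
  exact: (congr1 (fun T : K -> K => T u) (annihilation_creation (ch j) (ch i))).
by rewrite oh (negbTE ij) scale0r ip0l.
Qed.

Lemma field_right_eq_scalar (x : K) : ip x (vacuum K) = 0 ->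
  (forall h : R -> R, L2R h -> field_op K h x = right_field h x) -> x = 0.
Proof.
move=> x0 hx; pose a n := adj (creation K (cplx (@unit_bump R n))).
have nR (u : K) : exists r : R, `|u| = r%:C.
  by apply/complex_realP; apply: normr_real.
have [r Er] := nR x.
have /choice [p Ep] := fun i => nR (a i x).
have /choice [q Eq] := fun i => nR (a i (W x)).
have cb i : L2C (cplx (@unit_bump R i)) by apply: L2C_cplx; exact: L2R_unit_bump.
have bs (u : K) n := @annihilation_bessel _ u n cb (@dotL2_unit_bump R).
(* Using (p + q) r <= r^2/4 + (p + q)^2; the sum over i is at most 20 r^2 by
   Bessel, so seven indices suffice. *)
have key i : 3 * r ^+ 2 <= 10 * (p i ^+ 2 + q i ^+ 2).
  have h1 : dotL2 (cplx (@unit_bump R i)) (cplx (@unit_bump R i)) = 1.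
    by rewrite dotL2_unit_bump eqxx.
  have := central_norm_le (L2R_unit_bump R i) h1 x0 (hx _ (L2R_unit_bump R i)).
  rewrite /= -/(a i) Er Ep Eq -rmorphXn -!(rmorphD, rmorphM) lecR => H.
  (* The first square bounds (p + q) r by r^2/4 + (p + q)^2; the second bounds p q and (p + q)^2 by
     multiples of p^2 + q^2. *)
  have := sqr_ge0 (r - 2 * (p i + q i)); have := sqr_ge0 (p i - q i).
  by move: H; rewrite !expr2; nra.
have sp : \sum_(i < 7) p i ^+ 2 <= r ^+ 2.
  have := bs x 7%N; rewrite Er -rmorphXn.
  rewrite (eq_bigr (fun i : 'I_7 => (p i ^+ 2)%:C)) => [|i _].
    by rewrite -rmorph_sum lecR.
  by rewrite -/(a i) Ep rmorphXn.
have sq : \sum_(i < 7) q i ^+ 2 <= r ^+ 2.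
  have := bs (W x) 7%N; rewrite flip_norm Er -rmorphXn.
  rewrite (eq_bigr (fun i : 'I_7 => (q i ^+ 2)%:C)) => [|i _].
    by rewrite -rmorph_sum lecR.
  by rewrite -/(a i) Eq rmorphXn.
have : \sum_(i < 7) 3 * r ^+ 2 <= \sum_(i < 7) 10 * (p i ^+ 2 + q i ^+ 2).
  by apply: ler_sum => i _; exact: key.
rewrite -!mulr_sumr big_split /= sumr_const card_ord -mulr_natr => H.
have r2 : r ^+ 2 <= 0 by move: H sp sq; lra.
have /eqP : r ^+ 2 == 0 by rewrite eq_le r2 sqr_ge0.
move/eqP; rewrite expf_eq0 /= => /eqP r0.
by apply/eqP; rewrite -normr_eq0 Er r0.
Qed.
End Flip.

(** * Cyclicity of the vacuum *)

Lemma tens_ReIm g gs : L2seq (g :: gs) ->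
  tens K (g :: gs) = tens K (cplx (fun t => complex.Re (g t)) :: gs)
    + 'i *: tens K (cplx (fun t => complex.Im (g t)) :: gs).
Proof.
move=> hg; have [[rg ig] hgs] := (L2seq_cons _ _).1 hg.
have hr : L2seq (cplx (fun t => complex.Re (g t)) :: gs).
  by apply/L2seq_cons; split=> //; exact: L2C_cplx.
have hi : L2seq (cplx (fun t => complex.Im (g t)) :: gs).
  by apply/L2seq_cons; split=> //; exact: L2C_cplx.
(* Linearity of [tens] in its first letter is read off from the Gram formula by testing against
   simple tensors. *)
apply: tens_ext_vec => -[|k ks] hks; first by rewrite ipDl ipZl !ip_tens_nil // mulr0 addr0.
have [hk _] := (L2seq_cons _ _).1 hks.
by rewrite ipDl ipZl !ip_tens_cons // dotL2_ReIm // mulrDl mulrA.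
Qed.

(** For real h, the tensor h (x) gs equals S(h) gs - l(h)* gs, so the action of [F] on it is
    determined by shorter tensors; complex first letters are split into real and imaginary parts. *)
Lemma field_cyclic (F : K -> K) c : bounded_op F -> F (vacuum K) = c *: vacuum K ->
  (forall h : R -> R, L2R h -> F \o field_op K h = field_op K h \o F) ->
  F = c *: (idfun : K -> K).
Proof.
move=> bF F0 Fc.
have bid : bounded_op (c *: (idfun : K -> K)).
  rewrite -[_ *: _]addr0; apply: bounded_scaleD; first exact: bounded_idfun.
  exact: bounded_zero.
have FcE (h : R -> R) u : L2R h -> F (field_op K h u) = field_op K h (F u).
  by move=> hh; rewrite -[LHS]/((F \o field_op K h) u) Fc.
pose P gs := L2seq gs -> F (tens K gs) = c *: tens K gs.
(* The annihilation term drops one more letter from the tail, so the induction carries two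
   consecutive lengths. *)
have PP gs : P gs /\ P (behead gs).
  elim: gs => [|g gs [ih1 ih2]]; first by split=> _; exact: F0.
  split=> // hg; have [[rg ig] hgs] := (L2seq_cons _ _).1 hg.
  have real (h : R -> R) : L2R h -> F (tens K (cplx h :: gs)) = c *: tens K (cplx h :: gs).
    move=> hh; have bS := field_bounded hh.
    have hann : F (ann_tens (cplx h) gs) = c *: ann_tens (cplx h) gs.
      case: gs hg hgs ih1 ih2 => [|g' gs] hg hgs ih1 ih2 /=.
        by rewrite bounded0 // scaler0.
      rewrite boundedZ // ih2 ?scalerA 1?mulrC //.
      by have [] := (L2seq_cons _ _).1 hgs.
    have -> : tens K (cplx h :: gs) = field_op K h (tens K gs) - ann_tens (cplx h) gs.
      by rewrite field_tens // addrK.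
    by rewrite boundedB // FcE // ih1 // hann boundedZ // scalerBr.
  rewrite tens_ReIm // boundedD // boundedZ // !real //.
  by rewrite scalerDr !scalerA [c * _]mulrC.
apply: tens_eq => // gs hgs; exact: (PP gs).1.
Qed.
End Fock.

(** * Central elements are scalar *)

Unset Implicit Arguments.

Theorem theorem9 (R : realType) (K : fock R) (L : L2SCSCop K)
    (nabla : (K -> K) -> R -> L) (hnabla : malliavin nabla)
    (F : K -> K) (hF : D12_SC nabla F)
    (hcomm : forall X : K -> K, SC X -> F \o X = X \o F) :
  exists c : R[i], F = c *: (idfun : K -> K).
Proof.
have [FSC _] := hF; have [W [bW tW aW WW]] := flip_exists K.
(* Only the boundedness of [F] is extracted here; the choice of function is immaterial. *)
have [bF _] := SC_commutes_right bW tW aW FSC (L2R_unit_bump R 0).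
have FS (h : R -> R) : L2R h -> F \o field_op K h = field_op K h \o F.
  by move=> hh; apply: hcomm => M [vM sM]; apply: sM; exists h.
pose c := ip (F (vacuum K)) (vacuum K); exists c.
apply: field_cyclic => //; apply/subr0_eq/(field_right_eq_scalar bW tW aW WW).
  by rewrite ipBl ipZl ip_vacuum mulr1 subrr.
move=> h hh; have bS := field_bounded K hh; have bR := right_field_bounded bW hh.
have [_ FR] := SC_commutes_right bW tW aW FSC hh.
(* Both fields send the vacuum to the one-letter tensor h; since [F] commutes with each of them,
   they agree on F Omega as well. *)
have S0 : field_op K h (vacuum K) = right_field W h (vacuum K).
  rewrite right_field_nil // field_tens //=; exact: addr0.
have FSE : F (field_op K h (vacuum K)) = field_op K h (F (vacuum K)).
  exact: (congr1 (fun T : K -> K => T (vacuum K)) (FS h hh)).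
have FRE : F (right_field W h (vacuum K)) = right_field W h (F (vacuum K)).
  exact: (congr1 (fun T : K -> K => T (vacuum K)) FR).
rewrite (boundedB _ _ bS) (boundedZ _ _ bS) (boundedB _ _ bR) (boundedZ _ _ bR).
by rewrite -FSE -FRE S0.
Qed.
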